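(* Let $P,I\in\mathbb{R}_{max}^{n\times n}$ with $P_{ii}\ne-\infty$ for all $i\in\{1,\dots,n\}$, let $\mathcal{G}(P,I)=(N,\{\mathsf{p},\mathsf{i}\},\mu,E)$, and let $\mathcal{S}=\mathcal{S}(\{\mathsf{p}\},\{\mathsf{i}\},\lfloor n/2\rfloor)$. Then $\mathcal{G}(P,I)\in\Gamma_M$ if and only if $\mathcal{G}(\mu(\mathsf{p}\mathcal{S}^* ))\in\Gamma$ and $\mathcal{G}(\mu(\mathsf{i}\mathcal{S}^* ))\in\Gamma$.
   Context: Max-plus: $\bar{\mathbb{R}}_{max}=\mathbb{R}\cup\{\pm\infty\}$, $\mathbb{R}_{max}=\mathbb{R}\cup\{-\infty\}$, $\oplus=\max$, $\otimes=+$ with $-\infty$ absorbing; matrix operations are max-plus, $E_\otimes$ the identity ($0$ diagonal, $-\infty$ elsewhere), $A^*=\bigoplus_{k\ge0}A^k$. Precedence graph $\mathcal{G}(A)$: nodes $\{1..n\}$, arc $(j,i)$ of weight $A_{ij}$ iff $A_{ij}\ne-\infty$; $\Gamma$ is the set of precedence graphs with no circuit of positive weight (weight = sum of arc weights). The multi-precedence graph $\mathcal{G}(P,I)$ has nodes $\{1..n\}$, alphabet $\{\mathsf{p},\mathsf{i}\}$, and a labeled arc $(j,i,\mathsf{p})$ of weight $P_{ij}$ iff $P_{ij}\ne-\infty$ and $(j,i,\mathsf{i})$ of weight $I_{ij}$ iff $I_{ij}\ne-\infty$; $\Gamma_M$ is the set of multi-precedence graphs with no circuit of positive weight. $\mu(\mathsf{p})=P$,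 $\mu(\mathsf{i})=I$, extended to languages by $\mu(\{\mathsf{e}\})=E_\otimes$, $\mu(s_1\cdots s_m)=\mu(s_1)\otimes\cdots\otimes\mu(s_m)$, $\mu(\mathcal{L})=\bigoplus_{s\in\mathcal{L}}\mu(s)$. Languages: $+$ union, juxtaposition concatenation, $\mathsf{e}$ empty string, $\mathcal{L}^*=\bigcup_{k\ge0}\mathcal{L}^k$. $\mathcal{S}(\mathcal{L}_1,\mathcal{L}_2,0)=\{\mathsf{e}\}$ and $\mathcal{S}(\mathcal{L}_1,\mathcal{L}_2,k)=\mathcal{L}_1\mathcal{S}(\mathcal{L}_1,\mathcal{L}_2,k-1)^2\mathcal{L}_2+\mathcal{L}_2\mathcal{S}(\mathcal{L}_1,\mathcal{L}_2,k-1)^2\mathcal{L}_1+\{\mathsf{e}\}$ for $k\ge1$. *)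

(* Defs.v *)
From mathcomp Require Import all_boot all_order all_algebra.
From mathcomp Require Import classical_sets reals ereal.

Set Implicit Arguments.
Unset Strict Implicit.
Unset Printing Implicit Defensive.

Local Open Scope classical_set_scope.
Local Open Scope ring_scope.
Local Open Scope ereal_scope.

(* Max-plus matrices have entries in \bar R. The library addition of \bar R
   satisfies -oo + x = -oo for every x, including +oo, so it is the max-plus
   product. *)

Definition mp_mul (R : realType) (n : nat) (A B : 'M[\bar R]_n) :
    'M[\bar R]_n :=
  \matrix_(i, j) \big[maxe/-oo]_(k < n) (A i k + B k j).

Definition mp_id (R : realType) (n : nat) : 'M[\bar R]_n :=
  \matrix_(i, j) (if i == j then 0 else -oo).

Definition language (T : Type) := set (seq T).

Definition lang_cat (T : Type) (L1 L2 : language T) : language T :=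
  [set s | exists u v, [/\ L1 u, L2 v & s = u ++ v]].

Fixpoint lang_pow (T : Type) (L : language T) (k : nat) : language T :=
  if k is k'.+1 then lang_cat L (lang_pow L k') else [set [::]].

Definition lang_star (T : Type) (L : language T) : language T :=
  \bigcup_k lang_pow L k.

Fixpoint lang_S (T : Type) (L1 L2 : language T) (k : nat) : language T :=
  if k is k'.+1 then
    let S2 := lang_pow (lang_S L1 L2 k') 2 in
    lang_cat L1 (lang_cat S2 L2) `|` lang_cat L2 (lang_cat S2 L1)
      `|` [set [::]]
  else [set [::]].

Section Morphism.
Variables (R : realType) (n : nat) (T : Type) (mu : T -> 'M[\bar R]_n).

Definition mu_word (s : seq T) : 'M[\bar R]_n :=
  foldr (fun z M => mp_mul (mu z) M) (mp_id R n) s.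

(* The supremum over an infinite language may be +oo. *)
Definition mu_lang (L : language T) : 'M[\bar R]_n :=
  \matrix_(i, j) ereal_sup [set mu_word s i j | s in L].

End Morphism.

(* A weighted directed graph with nodes in N; is_arc selects the actual arcs
   among the candidates in the type arc, which allows labeled parallel arcs. *)
Record wgraph (R : realType) (N : eqType) := WGraph {
  arc : Type;
  source : arc -> N;
  target : arc -> N;
  is_arc : pred arc;
  weight : arc -> \bar R
}.

(* A circuit is a closed path, not necessarily elementary, given by its
   nonempty sequence of arcs. *)
Definition circuit (R : realType) (N : eqType) (G : wgraph R N)
    (c : seq (arc G)) : Prop :=
  [/\ (0 < size c)%N, all (@is_arc R N G) c
    & cycle (fun a b => target a == source b) c].

Definition circuit_weight (R : realType) (N : eqType) (G : wgraph R N)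
    (c : seq (arc G)) : \bar R :=
  \sum_(a <- c) weight a.

(* Applied to precedence_graph this is membership in Gamma, applied to
   multi_precedence_graph it is membership in Gamma_M. *)
Definition no_positive_circuit (R : realType) (N : eqType)
    (G : wgraph R N) : Prop :=
  ~ exists c : seq (arc G), circuit c /\ 0 < circuit_weight c.

(* The pair (j, i) is the arc from j to i, whose weight is A i j. *)
Definition precedence_graph (R : realType) (n : nat) (A : 'M[\bar R]_n) :
    wgraph R 'I_n :=
  @WGraph R 'I_n ('I_n * 'I_n)%type
    (fun a => a.1) (fun a => a.2)
    (fun a => A a.2 a.1 != -oo) (fun a => A a.2 a.1).

(* The triple (j, i, z) is the arc from j to i labeled z, of weight
   mu z i j. *)
Definition multi_precedence_graph (R : realType) (n : nat) (T : Type)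
    (mu : T -> 'M[\bar R]_n) : wgraph R 'I_n :=
  @WGraph R 'I_n ('I_n * 'I_n * T)%type
    (fun a => a.1.1) (fun a => a.1.2)
    (fun a => mu a.2 a.1.2 a.1.1 != -oo) (fun a => mu a.2 a.1.2 a.1.1).

Inductive letter := Lp | Li.

Definition mu_PI (R : realType) (n : nat) (P I : 'M[\bar R]_n) (z : letter) :
    'M[\bar R]_n :=
  match z with Lp => P | Li => I end.

(* Main.v *)
(** Rotating a closed walk keeps its weight, and a positive circuit always contains
    one of length at most [n].  If the label of the latter has as many [p]'s as
    [i]'s, it is a product of words of [S], because nesting depth [n/2] suffices
    for balanced words of length at most [n]; repeating it often enough outweighs
    the loop [P x x], which yields a positive loop of the graph for [p].  If the
    label has [d > 0] more [p]'s than [i]'s, a rotation of it is a product of [d]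
    words [p b] with [b] balanced, that is, a circuit of length [d] of the graph
    for [p]; a surplus of [i]'s is symmetric.  Conversely, the weight of a circuit
    of either graph is bounded by a supremum of weights of circuits of the
    multi-precedence graph. *)

Require Import Defs.
From mathcomp Require Import all_boot all_order all_algebra.
From mathcomp Require Import classical_sets reals ereal.
From mathcomp Require Import zify.

Set Implicit Arguments.
Unset Strict Implicit.
Unset Printing Implicit Defensive.

Import Order.TTheory GRing.Theory Num.Theory.

Local Open Scope classical_set_scope.
Local Open Scope ring_scope.
Local Open Scope ereal_scope.

(** * Letter counts and powers of languages *)

Section Words.
Variable T : Type.
Implicit Types (a : pred T) (w u v : seq T) (L : language T).

Definition balanced a w := count a w = count (predC a) w.

(** Induction from the left. A letter in [a] opens a block with the balanced prefix of the tail,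
    unless [d = 0], when the whole word is balanced. Any other letter raises the surplus of the tail
    to [d.+1], and the prefix swallows the tail's first block. *)
Lemma split_surplus a w d n :
    count a w = (count (predC a) w + d)%N -> (size w <= n)%N ->
  let L := lang_cat [set [:: x] | x in [set x | a x]]
                    [set b | balanced a b /\ (size b <= n)%N] in
  exists b v, [/\ w = b ++ v, balanced a b, (size b <= n)%N & lang_pow L d v].
Proof.
move=> /[swap] szw cw L; elim: w d cw szw => [|x w IHw] d /=.
  move=> d0 _; exists [::], [::]; split=> //.
  by rewrite (_ : d = 0%N) //=; lia.
rewrite /balanced; case ax: (a x) => /= cw szw.
  case: d cw => [|d] cw.
    exists (x :: w), [::]; split; rewrite ?cats0 //=.
    by rewrite /balanced /= ax /=; lia.
  case: (IHw d) => [||b [v [ew bb szb Lv]]]; [lia|lia|].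
  exists [::], (x :: w); split=> //; exists (x :: b), v; split=> //.
    by exists [:: x], b; split=> //; exists x.
  by rewrite ew.
case: (IHw d.+1) => [||b [v [ew bb szb]]]; [lia|lia|].
move=> [s [v' [[_ [b' [[y ay <-] [bb' szb'] ->]]] Lv' ev]]].
clear IHw; rewrite {v}ev in ew; rewrite {w}ew in cw szw *.
exists (x :: b ++ y :: b'), v'; split=> //.
- by rewrite /= -!catA.
- by move: bb bb'; rewrite /balanced /= !count_cat /= ax ay; lia.
- by move: szw; rewrite /= !size_cat /= !size_cat; lia.
Qed.

(* Reading the letters in [a] as up-steps and the others as down-steps, a path
   from height [-h <= 0] to height at least [2] has two consecutive up-steps the
   first of which leaves height [0]. *)
Lemma double_crossing a w h :
    (count (predC a) w + h + 2 <= count a w)%N ->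
  exists u x y v, [/\ w = u ++ x :: y :: v, a x, a y
    & count a u = (count (predC a) u + h)%N].
Proof.
have [m] := ubnP (size w).
elim: m w h => // m IHm [|x w] h /= szw; first by lia.
case ax: (a x) => /= cw; last first.
  case: (IHm w h.+1) => [||u [y [z [v [-> ay az cu]]]]]; [lia|lia|].
  by exists (x :: u), y, z, v; split=> //=; rewrite ax /=; lia.
case: h cw => [|h] cw; last first.
  case: (IHm w h) => [||u [y [z [v [-> ay az cu]]]]]; [lia|lia|].
  by exists (x :: u), y, z, v; split=> //=; rewrite ax /=; lia.
case: w szw cw => [|y w] /= szw; first by lia.
case ay: (a y) => /= cw; first by exists [::], x, y, w.
case: (IHm w 0%N) => [||u [x' [y' [v [-> ax' ay' cu]]]]]; [lia|lia|].
by exists [:: x, y & u], x', y', v; split=> //=; rewrite ax ay /=; lia.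
Qed.

Lemma lang_powD L j k u v :
  lang_pow L j u -> lang_pow L k v -> lang_pow L (j + k) (u ++ v).
Proof.
move=> + Lv; elim: j u => [|j IHj] u /=; first by move=> ->.
move=> [s [t [Ls Lt ->]]]; exists s, (t ++ v); split=> //; first exact: IHj.
by rewrite catA.
Qed.

Lemma lang_star_cat L u v :
  lang_star L u -> lang_star L v -> lang_star L (u ++ v).
Proof.
by move=> [j _ Lu] [k _ Lv]; exists (j + k)%N => //; exact: lang_powD.
Qed.

Lemma lang_star_iter L w N :
  lang_star L w -> lang_star L (iter N (cat w) [::]).
Proof.
move=> Lw; elim: N => [|N IHN]; first by exists 0%N.
exact: lang_star_cat.
Qed.

Lemma lang_catS L1 L2 L1' L2' :
  L1 `<=` L1' -> L2 `<=` L2' -> lang_cat L1 L2 `<=` lang_cat L1' L2'.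
Proof.
by move=> s1 s2 _ [u [v [/s1 Lu /s2 Lv ->]]]; exists u, v.
Qed.

(** Rotation puts a balanced prefix behind the last block, whose star absorbs it; the exponent
    [k.+1] ensures that there is a last block. *)
Lemma lang_pow_star_absorb L1 L k u v :
    lang_pow (lang_cat L1 (lang_star L)) k.+1 u -> lang_star L v ->
  lang_pow (lang_cat L1 (lang_star L)) k.+1 (u ++ v).
Proof.
move=> + Lv; elim: k u => [|k IHk] _ [s [t [Ls Lt ->]]].
  case: Ls => [s1 [s2 [L1s Ls ->]]]; rewrite (Lt : t = [::]) cats0 -catA.
  exists (s1 ++ s2 ++ v), [::]; rewrite cats0; split=> //.
  by exists s1, (s2 ++ v); split=> //; exact: lang_star_cat.
by exists s, (t ++ v); rewrite catA; split=> //; exact: IHk.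
Qed.

Lemma lang_powS L L' k : L `<=` L' -> lang_pow L k `<=` lang_pow L' k.
Proof.
by move=> sL; elim: k => //= k IHk; exact: lang_catS.
Qed.

End Words.

Definition isLp (z : letter) : bool := if z is Lp then true else false.

Lemma balanced_isLp a w :
  a =1 isLp \/ a =1 predC isLp -> balanced a w <-> balanced isLp w.
Proof.
have := count_predC a w; have := count_predC isLp w; rewrite /balanced.
by move=> + + [] /eq_count/(_ w); lia.
Qed.

(** * Balanced words and bounded nesting depth *)

Section BalancedInS.
Local Notation S := (lang_S [set [:: Lp]] [set [:: Li]]).

Lemma lang_S_nil k : S k [::].
Proof. by case: k => //= k; right. Qed.

Lemma lang_S_sandwich k x y w :
  isLp x != isLp y -> lang_pow (S k) 2 w -> S k.+1 (x :: rcons w y).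
Proof.
move=> xy Sw; left; rewrite -cats1.
case: x y xy => [] [] //= _; [left|right].
  by exists [:: Lp], (w ++ [:: Li]); split=> //; exists w, [:: Li].
by exists [:: Li], (w ++ [:: Lp]); split=> //; exists w, [:: Lp].
Qed.

(* If the two end letters of [w] differ, stripping them leaves a balanced word;
   if they agree, the path of [w] crosses height [0] strictly and splits there
   into two balanced words whose end letters differ. *)
Lemma balanced_lang_S k w :
  balanced isLp w -> (size w <= k.*2)%N -> lang_pow (S k) 2 w.
Proof.
elim: k w => [|k IHk] w bw szw.
  case: w szw {bw} => // _.
  by exists [::], [::]; split=> //; exists [::], [::].
have S2 u v : S k.+1 u -> S k.+1 v -> lang_pow (S k.+1) 2 (u ++ v).
  by move=> Su Sv; exists u, v; split=> //; exists v, [::]; rewrite cats0.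
case: w bw szw => [|x w].
  by move=> _ _; apply: (S2 [::] [::]); exact: lang_S_nil.
case/lastP: w => [|w y]; first by case: x.
rewrite /balanced /= -cats1 !count_cat /= size_cat /= cats1 => bw szw.
have [xy|xy] := boolP (isLp x != isLp y).
  rewrite -[x :: _]cats0; apply: S2; last exact: lang_S_nil.
  apply: lang_S_sandwich => //; apply: IHk; last by lia.
  by move: bw xy; rewrite /balanced; case: (x) (y) => [] [] //=; lia.
have {xy}eyx : y = x by move: xy; case: (x) (y) => [] [].
rewrite {y}eyx in bw szw *.
(* Stripping two equal end letters leaves a surplus of two of the other letter, which [a] reads as
   up-steps. *)
pose a z := isLp z != isLp x.
have aE : a =1 isLp \/ a =1 predC isLp.
  by rewrite /a; case: (x); [right|left] => -[].
have caE : (count a w = count (predC a) w + 2)%N.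
  have := count_predC a w; have := count_predC isLp w.
  move: bw; rewrite /a; case: (x) => /=.
    rewrite (@eq_count _ (fun z => isLp z != true) (predC isLp)) => [|[]] //.
    by lia.
  by rewrite (@eq_count _ (fun z => isLp z != false) isLp) => [|[]] //; lia.
case: (@double_crossing _ a w 0) => [|u [y [z [v [ew ay az cu]]]]].
  by rewrite caE; lia.
have bu : balanced isLp u by apply/(balanced_isLp _ aE); rewrite /balanced; lia.
have bv : balanced isLp v.
  apply/(balanced_isLp _ aE).
  by move: caE; rewrite /balanced ew !count_cat /= ay az; lia.
rewrite ew size_cat /= in szw.
rewrite ew (_ : x :: _ = (x :: rcons u y) ++ (z :: rcons v x)); last first.
  by rewrite /= -!cats1 -!catA.
apply: S2; apply: lang_S_sandwich => //.
- by rewrite eq_sym.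
- by apply: IHk => //; lia.
- by apply: IHk => //; lia.
Qed.

Lemma balanced_lang_star n w :
  balanced isLp w -> (size w <= n)%N -> lang_star (S n./2) w.
Proof.
move=> bw szw; exists 2%N => //; apply: balanced_lang_S => //.
(* A balanced word has even length, so rounding [n./2] down loses nothing. *)
by move: (count_predC isLp w) szw; rewrite -bw; lia.
Qed.

End BalancedInS.

(** * Walks in weighted graphs *)

Section Walks.
Variables (R : realType) (N : eqType) (G : wgraph R N).
Implicit Types (a b : Defs.arc G) (c : seq (Defs.arc G)) (x y z : N).

(** Explicit endpoints and an empty walk make cutting and gluing possible, which [cycle] does not
    offer directly. *)
Fixpoint walk x c y : bool :=
  if c is a :: c' then (x == source a) && walk (target a) c' y else x == y.

Lemma walk_cat x c1 c2 y :
  walk x (c1 ++ c2) y <-> exists2 z, walk x c1 z & walk z c2 y.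
Proof.
elim: c1 x => [|a c1 IHc] x /=.
  by split=> [w|[z /eqP -> //]]; exists x.
split=> [/andP[-> /IHc[z w1 w2]]|[z /andP[-> w1] w2]]; first by exists z.
by apply/IHc; exists z.
Qed.

Lemma walk_path a c b :
  walk (target a) c (source b)
    = path (fun a b => target a == source b) a (rcons c b).
Proof. by elim: c a => [|d c IHc] a /=; rewrite ?andbT ?IHc. Qed.

Lemma circuit_walk c :
  circuit c <->
  [/\ (0 < size c)%N, all (@is_arc R N G) c & exists x, walk x c x].
Proof.
rewrite /circuit; split=> -[sc ac w]; split=> //.
  case: c sc ac w => // a c _ _ /=; rewrite -walk_path => w.
  by exists (source a); rewrite eqxx.
case: c sc ac w => // a c _ _ /= [x /andP[/eqP -> w]].
by rewrite -walk_path.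
Qed.

Lemma circuit_weight_cat c1 c2 :
  circuit_weight (c1 ++ c2) = circuit_weight c1 + circuit_weight c2.
Proof. by rewrite /circuit_weight big_cat. Qed.

Lemma circuit_weight_cons a c :
  circuit_weight (a :: c) = weight a + circuit_weight c.
Proof. by rewrite /circuit_weight big_cons. Qed.

Lemma circuit_weight1 a : circuit_weight [:: a] = weight a.
Proof. by rewrite /circuit_weight big_seq1. Qed.

End Walks.

(** * Extraction of a short positive circuit *)

Lemma not_uniq_map_split (A : Type) (B : eqType) (f : A -> B) s :
    ~~ uniq (map f s) ->
  exists s1 a s2 b s3, s = s1 ++ (a :: s2) ++ b :: s3 /\ f a = f b.
Proof.
elim: s => //= a s IHs; rewrite negb_and negbK => /orP[|/IHs].
  move=> fa; suff [s2 [b [s3 [-> e]]]] :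
      exists s2 b s3, s = s2 ++ b :: s3 /\ f a = f b.
    by exists [::], a, s2, b, s3.
  elim: s fa {IHs} => //= b s IHs; rewrite inE => /orP[/eqP e|/IHs].
    by exists [::], b, s.
  by move=> [s2 [d [s3 [-> e]]]]; exists (b :: s2), d, s3.
by move=> [s1 [b [s2 [d [s3 [-> e]]]]]]; exists (a :: s1), b, s2, d, s3.
Qed.

(** More than [#|N|] arcs force a repeated source. Cutting there yields two shorter circuits whose
    weights add up to the original one, so one of them is positive. *)
Lemma short_positive_circuit (R : realType) (N : finType) (G : wgraph R N)
    (c : seq (Defs.arc G)) :
    circuit c -> 0 < circuit_weight c ->
  exists c' : seq (Defs.arc G),
    [/\ circuit c', 0 < circuit_weight c' & (size c' <= #|N|)%N].
Proof.
have [m] := ubnP (size c); elim: m c => // m IHm c szc cc wc.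
have [szn|nsz] := leqP (size c) #|N|; first by exists c.
have /not_uniq_map_split : ~~ uniq (map (@source R N G) c).
  apply: contraL nsz => /card_uniqP; rewrite size_map -leqNgt => <-.
  exact: max_card.
move=> [c1 [a [c2 [b [c3 [ec eab]]]]]].
case/circuit_walk: cc => _; rewrite ec !all_cat => /and3P[ac1 ac2 ac3] [x].
case/walk_cat => y w1 /walk_cat[z w2 w3].
have eya : y = source a by move: w2 => /= /andP[/eqP].
have ezb : z = source b by move: w3 => /= /andP[/eqP].
rewrite {}eya {}ezb -eab in w1 w2 w3.
have [p2|n2] := ltP 0 (circuit_weight (a :: c2)).
  apply: (IHm (a :: c2)) => //.
    by move: szc; rewrite ec !size_cat /=; lia.
  by apply/circuit_walk; split=> //; exists (source a).
apply: (IHm (c1 ++ b :: c3)).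
- by move: szc; rewrite ec !size_cat /=; lia.
- apply/circuit_walk; split; first by rewrite size_cat /=; lia.
    by rewrite all_cat ac1.
  by exists x; apply/walk_cat; exists (source a).
- move: wc; rewrite ec !circuit_weight_cat addeCA => /lt_le_trans; apply.
  by rewrite -[leRHS]add0e; apply: leeD.
Qed.

(** * Max-plus products along words and weights of walks *)

Section MaxPlusWords.
Variables (R : realType) (n : nat) (T : Type) (mu : T -> 'M[\bar R]_n).
Implicit Types (i j k x y : 'I_n) (s u v w : seq T) (L : language T).
Local Notation mw := (mu_word mu).
Local Notation G := (multi_precedence_graph mu).

Lemma mp_mul_ge (A B : 'M[\bar R]_n) i k j :
  A i k + B k j <= mp_mul A B i j.
Proof. by rewrite mxE; apply: (le_bigmax -oo (fun k => A i k + B k j)). Qed.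

Lemma mp_mul_attained (A B : 'M[\bar R]_n) i j :
  exists k, mp_mul A B i j = A i k + B k j.
Proof.
rewrite mxE.
have [//||k _ ->] := @eq_bigmax _ _ _ -oo i predT (fun k => A i k + B k j).
  by move=> k _; exact: leNye.
by exists k.
Qed.

Lemma mu_word_nil i : mw [::] i i = 0.
Proof. by rewrite /= mxE eqxx. Qed.

(** Together with the reverse bound at some midpoint, this stands in for associativity of
    [mp_mul]. *)
Lemma mu_word_cat_ge u v i k j : mw u i k + mw v k j <= mw (u ++ v) i j.
Proof.
elim: u i => [|z u IHu] i /=.
  by rewrite mxE; case: eqP => [->|_]; rewrite ?add0e // addNye leNye.
have [l ->] := mp_mul_attained (mu z) (mw u) i k.
rewrite -addeA; apply: le_trans (mp_mul_ge _ _ i l j).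
exact: leeD.
Qed.

Lemma mu_word_cat_le u v i j :
  exists k, mw (u ++ v) i j <= mw u i k + mw v k j.
Proof.
elim: u i => [|z u IHu] i; first by exists i; rewrite mu_word_nil add0e.
rewrite /=; have [l ->] := mp_mul_attained (mu z) (mw (u ++ v)) i j.
have [k le_k] := IHu l; exists k.
apply: le_trans (leeD (mp_mul_ge (mu z) (mw u) i l k) (lexx _)).
by rewrite -addeA leeD.
Qed.

Lemma mu_word1 z i j : mw [:: z] i j = mu z i j.
Proof.
apply/eqP; rewrite eq_le; apply/andP; split.
  rewrite /=; have [k ->] := mp_mul_attained (mu z) (mp_id R n) i j.
  by rewrite mxE; case: eqP => [->|_]; rewrite ?adde0 // addeNy leNye.
have := mp_mul_ge (mu z) (mp_id R n) i j j.
by rewrite {1}/mp_id mxE eqxx adde0.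
Qed.

Lemma mu_word_rotate u v i :
  0 < mw (u ++ v) i i -> exists k, 0 < mw (v ++ u) k k.
Proof.
have [k le_k] := mu_word_cat_le u v i i; move=> /lt_le_trans/(_ le_k) lt_k.
by exists k; apply: lt_le_trans lt_k _; rewrite addeC; exact: mu_word_cat_ge.
Qed.

(* Arcs carry words right to left, since [mu z i j] weighs an arc from [j]
   to [i]. *)
Lemma walk_mu_word x (c : seq (Defs.arc G)) y :
  walk x c y -> circuit_weight c <= mw (rev (map snd c)) y x.
Proof.
elim: c x => [|a c IHc] x /=.
  by move=> /eqP ->; rewrite mxE eqxx /circuit_weight big_nil.
move=> /andP[/eqP -> w]; rewrite circuit_weight_cons rev_cons -cats1 addeC.
apply: le_trans (mu_word_cat_ge _ _ y a.1.2 _).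
by apply: leeD; [exact: IHc | rewrite mu_word1].
Qed.

Lemma mu_word_walk s i j : mw s i j != -oo ->
  exists c : seq (Defs.arc G), [/\ walk j c i, all (@is_arc _ _ G) c,
    size c = size s & circuit_weight c = mw s i j].
Proof.
elim: s i => [|z s IHs] i /=.
  rewrite mxE; case: (eqVneq i j) => [->|_]; rewrite ?eqxx // => _.
  exists [::]; split=> //=.
  by rewrite /circuit_weight big_nil.
have [k ->] := mp_mul_attained (mu z) (mw s) i j.
rewrite adde_eq_ninfty negb_or => /andP[nz /IHs[c [w ac szc wc]]].
exists (c ++ [:: ((k, i), z)]); split.
- by apply/walk_cat; exists k => //=; rewrite !eqxx.
- by rewrite all_cat ac /= nz.
- by rewrite size_cat szc addn1.
- by rewrite circuit_weight_cat circuit_weight1 wc addeC.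
Qed.

(** The delicate case is [r = +oo] with [t != +oo]: every element of [A] is then [-oo], and so is
    the sum on the left. *)
Lemma ge_ereal_supD (A : set (\bar R)) (r t : \bar R) :
  (forall a, A a -> a + r <= t) -> ereal_sup A + r <= t.
Proof.
case: r => [r| |] le_t.
- by rewrite -leeBrDr //; apply: ge_ereal_sup => a /le_t; rewrite leeBrDr.
- have [->|ninf] := eqVneq t +oo; first exact: leey.
  suff -> : ereal_sup A = -oo by rewrite addNye leNye.
  apply/eqP; rewrite -leeNy_eq; apply: ge_ereal_sup => a Aa.
  rewrite leeNy_eq; apply: contraNT ninf => na.
  by move: (le_t _ Aa); rewrite addey // leye_eq.
- by rewrite addeNy leNye.
Qed.

(** Each arc weight is a supremum over words of [L], and these suprema are pulled out arc by arc. As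
    words of [L] are nonempty, the concatenations are at least as long as [c], so a circuit yields a
    nonempty word. *)
Lemma walk_mu_lang_le L x
    (c : seq (Defs.arc (precedence_graph (mu_lang mu L)))) y :
    ~ L [::] -> walk x c y ->
  circuit_weight c
    <= ereal_sup [set mw s y x | s in [set s | (size c <= size s)%N]].
Proof.
move=> L0; elim: c x => [|a c IHc] x /=.
  move=> /eqP ->; rewrite /circuit_weight big_nil.
  by apply: ereal_sup_ubound; exists [::]; rewrite // mu_word_nil.
move=> /andP[/eqP -> /IHc w].
rewrite circuit_weight_cons /= mxE; apply: ge_ereal_supD => _ [u Lu <-].
apply: le_trans (leeD (lexx _) w) _; rewrite addeC.
apply: ge_ereal_supD => _ [v /= szv <-].
apply: le_trans (mu_word_cat_ge _ _ _ _ _) _.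
apply: ereal_sup_ubound; exists (v ++ u) => //=.
rewrite size_cat; case: u Lu => [/L0 //|z u _] /=; lia.
Qed.

Lemma no_positive_circuit_mu_lang L : ~ L [::] ->
  no_positive_circuit G ->
  no_positive_circuit (precedence_graph (mu_lang mu L)).
Proof.
move=> L0 noG [c [/circuit_walk[szc _ [x w]] wc]]; apply: noG.
have := lt_le_trans wc (walk_mu_lang_le L0 w).
(* The supremum need not be attained, but being positive it is already exceeded from [0] by a single
   word. *)
case/ereal_sup_gt => _ [s /= szs <-] ws.
have [|c' [w' ac' szc' wc']] := @mu_word_walk s x x.
  by rewrite -ltNye; exact: lt_trans ws.
exists c'; split; last by rewrite wc'.
apply/circuit_walk; split=> //; last by exists x.
by rewrite szc'; exact: leq_trans szs.
Qed.

(** Each of the [k] factors of [w] is dominated by one arc, whose weight is a supremum over [L]. *)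
Lemma lang_pow_walk L (k : nat) w i j : lang_pow L k w -> mw w i j != -oo ->
  exists c : seq (Defs.arc (precedence_graph (mu_lang mu L))),
    [/\ walk j c i, all (@is_arc _ _ _) c, size c = k
      & mw w i j <= circuit_weight c].
Proof.
elim: k w i => [|k IHk] w i /=.
  move=> -> /=; rewrite mxE; case: (eqVneq i j) => [->|_]; rewrite ?eqxx // => _.
  exists [::]; split=> //=.
  by rewrite /circuit_weight big_nil.
move=> [u [v [Lu Lv ->]]] nw; have [l le_l] := mu_word_cat_le u v i j.
have : mw u i l + mw v l j != -oo.
  by apply: contraNN nw => /eqP e; rewrite -leeNy_eq -e.
rewrite adde_eq_ninfty negb_or => /andP[nu /(IHk _ _ Lv)[c [wc ac szc le_c]]].
have le_u : mw u i l <= mu_lang mu L i l.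
  by rewrite mxE; apply: ereal_sup_ubound; exists u.
exists (c ++ [:: (l, i)]); split.
- by apply/walk_cat; exists l => //=; rewrite !eqxx.
- rewrite all_cat ac /= andbT; apply: contraNN nu => /eqP e.
  by rewrite -leeNy_eq -e.
- by rewrite size_cat szc addn1.
- rewrite circuit_weight_cat circuit_weight1 addeC.
  by apply: le_trans le_l _; exact: leeD.
Qed.

Lemma lang_pow_positive_circuit L (k : nat) w i :
  lang_pow L k.+1 w -> 0 < mw w i i ->
  ~ no_positive_circuit (precedence_graph (mu_lang mu L)).
Proof.
move=> Lw ww; apply.
have [|c [wc ac szc le_c]] := @lang_pow_walk L k.+1 w i i Lw.
  by rewrite -ltNye; exact: lt_trans ww.
exists c; split; last exact: lt_le_trans le_c.
by apply/circuit_walk; split=> //; [rewrite szc|exists i].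
Qed.

Lemma mu_word_iter_ge w i N (e : R) :
  e%:E <= mw w i i -> (e *+ N)%:E <= mw (iter N (cat w) [::]) i i.
Proof.
move=> le_e; elim: N => [|N IHN]; first by rewrite mu_word_nil.
rewrite mulrS EFinD /=; apply: le_trans (mu_word_cat_ge _ _ _ i _).
exact: leeD.
Qed.

Lemma mu_word_iter_gt0 w i (r : \bar R) : r != -oo -> 0 < mw w i i ->
  exists N, 0 < r + mw (iter N (cat w) [::]) i i.
Proof.
move=> nr wi.
(* The weight may be [+oo]; a finite positive lower bound is enough to iterate. *)
have [e e0 le_e] : exists2 e : R, (0 < e)%R & e%:E <= mw w i i.
  case: (mw w i i) wi => // [e|] ; first by rewrite lte_fin; exists e.
  by exists 1%R => //; exact: leey.
case: r nr => // [r|] _; last first.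
  by exists 0%N; rewrite mu_word_nil adde0 ltry.
(* Archimedes: this many copies of [e] exceed [|r|], hence [-r]. *)
exists (Num.bound (`|r| / e)%R).
apply: lt_le_trans (leeD (lexx _) (mu_word_iter_ge _ le_e)).
have := archi_boundP (divr_ge0 (normr_ge0 r) (ltW e0)).
rewrite -EFinD lte_fin -[(e *+ _)%R]mulr_natl ltr_pdivrMr // => lt_r.
by rewrite -ltrBlDl sub0r (le_lt_trans _ lt_r) // -normrN ler_norm.
Qed.

End MaxPlusWords.

(** * Unbalanced circuits and the equivalence *)

Lemma surplus_positive_circuit (R : realType) (n : nat)
    (mu : letter -> 'M[\bar R]_n) (z : letter) (w : seq letter) (x : 'I_n) :
  let a y := isLp y == isLp z in
  let S := lang_S [set [:: Lp]] [set [:: Li]] n./2 in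
  (count (predC a) w < count a w)%N -> (size w <= n)%N ->
  0 < mu_word mu w x x ->
  ~ no_positive_circuit
      (precedence_graph (mu_lang mu (lang_cat [set [:: z]] (lang_star S)))).
Proof.
move=> a S lt_w szw ww.
have aE : a =1 isLp \/ a =1 predC isLp.
  by rewrite /a; case: (z); [left|right] => -[].
(* The surplus is written as a successor because a circuit needs at least one block. *)
have cw : count a w
    = (count (predC a) w + (count a w - count (predC a) w).-1.+1)%N by lia.
have [b [v [ew bb szb Lv]]] := split_surplus cw szw.
have Sb : lang_star S b by apply/balanced_lang_star/szb/(balanced_isLp _ aE).
move/lang_powS: Lv => /(_ (lang_cat [set [:: z]] (lang_star S))) Lv.
(* Rotating [b ++ v] to [v ++ b] makes the word start with a block. *)
rewrite ew in ww; have [k vb] := mu_word_rotate ww.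
apply: lang_pow_positive_circuit vb; apply: lang_pow_star_absorb Sb; apply: Lv.
apply: lang_catS => [_ [y ay <-]|u [bu szu]].
  by move: ay; rewrite /a; case: (y) (z) => [] [].
by apply/balanced_lang_star/szu/(balanced_isLp _ aE).
Qed.

Theorem theorem3 (R : realType) (n : nat) (P I : 'M[\bar R]_n)
    (hP : forall i j : 'I_n, P i j != +oo)
    (hI : forall i j : 'I_n, I i j != +oo)
    (hdiag : forall i : 'I_n, P i i != -oo) :
  let mu := mu_PI P I in
  let p := [set [:: Lp]] : language letter in
  let i := [set [:: Li]] : language letter in
  let S := lang_S p i n./2 in
  no_positive_circuit (multi_precedence_graph mu) <->
  no_positive_circuit (precedence_graph (mu_lang mu (lang_cat p (lang_star S))))
  /\
  no_positive_circuit (precedence_graph (mu_lang mu (lang_cat i (lang_star S)))).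
Proof.
move=> mu p i S; split.
  move=> noG; split.
    (* Words of this language start with a fixed letter, so none is empty. *)
    by apply: no_positive_circuit_mu_lang noG => -[u [v [-> _]]].
  by apply: no_positive_circuit_mu_lang noG => -[u [v [-> _]]].
move=> [nop noi] [c0 [cc0 wc0]].
have [c [/circuit_walk[_ _ [x wc]] c_gt0]] := short_positive_circuit cc0 wc0.
rewrite card_ord => szc.
pose w := rev (map snd c).
have ww : 0 < mu_word mu w x x := lt_le_trans c_gt0 (walk_mu_word wc).
have szw : (size w <= n)%N by rewrite size_rev size_map.
have [lt_w|lt_w|bw] := ltngtP (count isLp w) (count (predC isLp) w).
- apply: (@surplus_positive_circuit _ _ mu Li w x) noi => //.
  have := count_predC (fun y => isLp y == isLp Li) w.
  have := count_predC isLp w.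
  rewrite (@eq_count _ (fun y => isLp y == isLp Li) (predC isLp)) => [|[]] //.
  by lia.
- apply: (@surplus_positive_circuit _ _ mu Lp w x) nop => //.
  have := count_predC (fun y => isLp y == isLp Lp) w.
  have := count_predC isLp w.
  by rewrite (@eq_count _ (fun y => isLp y == isLp Lp) isLp) => [|[]] //; lia.
(* In the balanced case [N] copies of [w] offset [P x x], which is not [-oo] by [hdiag]. *)
have [N ltN] := mu_word_iter_gt0 (hdiag x) ww.
have Sw := lang_star_iter N (balanced_lang_star bw szw).
pose pw := Lp :: iter N (cat w) [::].
(* The argument [0] stands for exponent one: the circuit is a loop at [x]. *)
apply: (@lang_pow_positive_circuit _ _ _ mu _ 0 pw x) nop.
  exists pw, [::]; rewrite cats0; split=> //.
  by exists [:: Lp], (iter N (cat w) [::]).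
by apply: lt_le_trans ltN _; exact: mp_mul_ge.
Qed.
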